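(* Let $\alpha\in\mathbb R\setminus\{0,1\}$ and $\lambda\in\{1,\alpha\}$. The Bessel–Fischer product is superhermitian on $\mathcal F_\lambda$, i.e. $$\langle p,q\rangle_{\mathcal B}=(-1)^{|p||q|}\,\overline{\langle q,p\rangle_{\mathcal B}}$$ for all $p,q\in\mathcal F_\lambda$ (homogeneous with respect to parity).
   Context: $\mathcal P(\mathbb C^{2|2})=\mathbb C[z_1,z_2]\otimes\Lambda(z_3,z_4)$, with $z_1,z_2$ even and $z_3,z_4$ odd; $|p|\in\mathbb Z/2$ is the parity of $p$ and $\partial_i=\partial_{z_i}$ are the (left) partial superderivatives. The Bessel operators are $\mathcal B_\lambda(z_1)=(-\lambda+z_1\partial_1+z_3\partial_3+z_4\partial_4)\partial_1-2\alpha z_2\partial_3\partial_4$, $\mathcal B_\lambda(z_2)=(-\tfrac{\lambda}{\alpha}+z_2\partial_2+z_3\partial_3+z_4\partial_4)\partial_2-2z_1\partial_3\partial_4$, $\mathcal B_\lambda(z_3)=(-2\lambda+2z_1\partial_1+2\alpha z_2\partial_2+2(1+\alpha)z_3\partial_3)\partial_4+z_3\partial_1\partial_2$, $\mathcal B_\lambda(z_4)=(2\lambda-2z_1\partial_1-2\alpha z_2\partial_2-2(1+\alpha)z_4\partial_4)\partial_3+z_4\partial_1\partial_2$. They supercommute. $\mathcal I_\lambda$ is the ideal of $\mathcal P(\mathbb C^{2|2})$ generated by $2z_1z_2+z_3z_4,\ z_2^2,\ z_2z_3,\ z_2z_4$ if $\lambda=\alpha$, and by $2\alpha z_1z_2+z_3z_4,\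 z_1^2,\ z_1z_3,\ z_1z_4$ if $\lambda=1$. The polynomial Fock space is $\mathcal F_\lambda=\mathcal P(\mathbb C^{2|2})/\mathcal I_\lambda$. The Bessel–Fischer product is $\langle p,q\rangle_{\mathcal B}=p(\mathcal B_\lambda)\,\bar q(z)|_{z=0}$, where $p(\mathcal B_\lambda)$ is obtained by replacing each monomial $z_1^{\gamma_1}z_2^{\gamma_2}z_3^{\gamma_3}z_4^{\gamma_4}$ of $p$ by $\mathcal B_\lambda(z_1)^{\gamma_1}\mathcal B_\lambda(z_2)^{\gamma_2}\mathcal B_\lambda(z_3)^{\gamma_3}\mathcal B_\lambda(z_4)^{\gamma_4}$ and $\bar q$ is obtained by conjugating the coefficients of $q$. It vanishes when either argument lies in $\mathcal I_\lambda$, hence is well defined on $\mathcal F_\lambda$. *)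

(* Defs.v *)
From HB Require Import structures.
From mathcomp Require Import all_boot all_order all_algebra.
From mathcomp Require Import ring.
From mathcomp Require Import boolp reals.
From mathcomp Require Import complex mpoly.

Set Implicit Arguments.
Unset Strict Implicit.
Unset Printing Implicit Defensive.

Import GRing.Theory.
Import Quotient.Exports.

Local Open Scope ring_scope.
Local Open Scope quotient_scope.

(* Superpolynomials K[z1, z2] (x) Lambda(z3, z4): [SPoly a b c d] stands for
   a + b z3 + c z4 + d z3 z4 (see [spolyE] below), with a, b, c, d in
   K[z1, z2]. The variables z1, z2 of K[z1, z2] are 'X_0 and 'X_1. *)
Record spoly (K : comNzRingType) := SPoly {
  sp0 : {mpoly K[2]};
  sp3 : {mpoly K[2]};
  sp4 : {mpoly K[2]};
  sp34 : {mpoly K[2]}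
}.

Section SuperPolynomials.
Variable K : comNzRingType.
Local Notation P := (spoly K).
Implicit Types (p q : P) (c : K).

Definition spoly_to_prod p := (sp0 p, sp3 p, sp4 p, sp34 p).
Definition spoly_of_prod (t : {mpoly K[2]} * {mpoly K[2]} * {mpoly K[2]} *
  {mpoly K[2]}) : P := SPoly t.1.1.1 t.1.1.2 t.1.2 t.2.

Lemma spoly_to_prodK : cancel spoly_to_prod spoly_of_prod.
Proof. by case. Qed.

HB.instance Definition _ := Choice.copy P (can_type spoly_to_prodK).

Lemma spolyP p q :
  [/\ sp0 p = sp0 q, sp3 p = sp3 q, sp4 p = sp4 q & sp34 p = sp34 q] -> p = q.
Proof. by case: p q => [? ? ? ?] [? ? ? ?] /= [-> -> -> ->]. Qed.

Definition spoly_add p q :=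
  SPoly (sp0 p + sp0 q) (sp3 p + sp3 q) (sp4 p + sp4 q) (sp34 p + sp34 q).

Definition spoly_opp p := SPoly (- sp0 p) (- sp3 p) (- sp4 p) (- sp34 p).

Fact spoly_addA : associative spoly_add.
Proof. by move=> p q r; apply: spolyP; split; rewrite /= addrA. Qed.
Fact spoly_addC : commutative spoly_add.
Proof. by move=> p q; apply: spolyP; split; rewrite /= addrC. Qed.
Fact spoly_add0 : left_id (SPoly 0 0 0 0) spoly_add.
Proof. by move=> p; apply: spolyP; split; rewrite /= add0r. Qed.
Fact spoly_addN : left_inverse (SPoly 0 0 0 0) spoly_opp spoly_add.
Proof. by move=> p; apply: spolyP; split; rewrite /= addNr. Qed.

HB.instance Definition _ :=
  GRing.isZmodule.Build P spoly_addA spoly_addC spoly_add0 spoly_addN.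

Definition spoly_mul p q := SPoly
  (sp0 p * sp0 q)
  (sp0 p * sp3 q + sp3 p * sp0 q)
  (sp0 p * sp4 q + sp4 p * sp0 q)
  (sp0 p * sp34 q + sp3 p * sp4 q - sp4 p * sp3 q + sp34 p * sp0 q).

Definition spoly_one : P := SPoly 1 0 0 0.

Fact spoly_mulA : associative spoly_mul.
Proof. by move=> p q r; apply: spolyP; split=> /=; ring. Qed.
Fact spoly_mul1l : left_id spoly_one spoly_mul.
Proof. by move=> p; apply: spolyP; split=> /=; ring. Qed.
Fact spoly_mul1r : right_id spoly_one spoly_mul.
Proof. by move=> p; apply: spolyP; split=> /=; ring. Qed.
Fact spoly_mulDl : left_distributive spoly_mul +%R.
Proof. by move=> p q r; apply: spolyP; split=> /=; ring. Qed.
Fact spoly_mulDr : right_distributive spoly_mul +%R.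
Proof. by move=> p q r; apply: spolyP; split=> /=; ring. Qed.
Fact spoly_one_neq0 : spoly_one != 0.
Proof. by apply/eqP => /(congr1 (@sp0 K)) /eqP; rewrite oner_eq0. Qed.

HB.instance Definition _ := GRing.Zmodule_isNzRing.Build P
  spoly_mulA spoly_mul1l spoly_mul1r spoly_mulDl spoly_mulDr spoly_one_neq0.

Definition spoly_scale c p :=
  SPoly (c *: sp0 p) (c *: sp3 p) (c *: sp4 p) (c *: sp34 p).

Fact spoly_scaleA c1 c2 p :
  spoly_scale c1 (spoly_scale c2 p) = spoly_scale (c1 * c2) p.
Proof. by apply: spolyP; split; rewrite /= scalerA. Qed.
Fact spoly_scale1 : left_id 1 spoly_scale.
Proof. by move=> p; apply: spolyP; split; rewrite /= scale1r. Qed.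
Fact spoly_scaleDr : right_distributive spoly_scale +%R.
Proof. by move=> c p q; apply: spolyP; split; rewrite /= scalerDr. Qed.
Fact spoly_scaleDl p : {morph spoly_scale^~ p : a b / a + b}.
Proof. by move=> a b; apply: spolyP; split; rewrite /= scalerDl. Qed.

HB.instance Definition _ := GRing.Zmodule_isLmodule.Build K P
  spoly_scaleA spoly_scale1 spoly_scaleDr spoly_scaleDl.

Fact spoly_scaleAl c p q : c *: (p * q) = (c *: p) * q.
Proof.
by apply: spolyP; split; rewrite /= ?scalerDr ?scalerN ?scalerAl.
Qed.

HB.instance Definition _ :=
  GRing.Lmodule_isLalgebra.Build K P spoly_scaleAl.

Definition spolyC (a : {mpoly K[2]}) : P := SPoly a 0 0 0.

Definition z1 : P := spolyC 'X_(0 : 'I_2).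
Definition z2 : P := spolyC 'X_(1 : 'I_2).
Definition z3 : P := SPoly 0 1 0 0.
Definition z4 : P := SPoly 0 0 1 0.

Lemma spolyE p : p = spolyC (sp0 p) + spolyC (sp3 p) * z3
  + spolyC (sp4 p) * z4 + spolyC (sp34 p) * z3 * z4.
Proof. by apply: spolyP; split=> /=; ring. Qed.

Lemma z3_sqr : z3 * z3 = 0.
Proof. by apply: spolyP; split=> /=; ring. Qed.
Lemma z4_sqr : z4 * z4 = 0.
Proof. by apply: spolyP; split=> /=; ring. Qed.
Lemma z4z3 : z4 * z3 = - (z3 * z4).
Proof. by apply: spolyP; split=> /=; ring. Qed.

Definition d1 p : P := SPoly (sp0 p)^`M(0) (sp3 p)^`M(0) (sp4 p)^`M(0)
  (sp34 p)^`M(0).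
Definition d2 p : P := SPoly (sp0 p)^`M(1) (sp3 p)^`M(1) (sp4 p)^`M(1)
  (sp34 p)^`M(1).
(* Left derivatives: d3 (z3 z4) = z4 and d4 (z3 z4) = - z3. *)
Definition d3 p : P := SPoly (sp3 p) 0 (sp34 p) 0.
Definition d4 p : P := SPoly (sp4 p) (- sp34 p) 0 0.

(* [true] is the odd parity. *)
Definition has_parity (e : bool) p : Prop :=
  if e then sp0 p = 0 /\ sp34 p = 0 else sp3 p = 0 /\ sp4 p = 0.

Definition eval0 p : K := (sp0 p).@[fun _ => 0].

End SuperPolynomials.

Arguments z1 {K}.
Arguments z2 {K}.
Arguments z3 {K}.
Arguments z4 {K}.

Section GeneratedIdeal.
Variable A : nzRingType.

Definition two_sided_ideal (J : A -> Prop) : Prop :=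
  [/\ J 0, forall x y, J x -> J y -> J (x - y)
    & forall a x, J x -> J (a * x) /\ J (x * a)].

Definition gen_ideal (s : seq A) : {pred A} := fun x =>
  `[< forall J, two_sided_ideal J -> (forall g, g \in s -> J g) -> J x >].

Fact gen_ideal_zmod_closed s : zmod_closed (gen_ideal s).
Proof.
split=> [|x y /asboolP Jx /asboolP Jy]; apply/asboolP => J idJ sJ.
  by case: idJ.
by case: (idJ) => _ JB _; apply: JB; [apply: Jx | apply: Jy].
Qed.

HB.instance Definition _ s :=
  GRing.isZmodClosed.Build A (gen_ideal s) (gen_ideal_zmod_closed s).

Lemma gen_ideal_two_sided s : two_sided_ideal (fun x => x \in gen_ideal s).
Proof.
split=> [|x y|a x /asboolP Jx]; first exact: rpred0.
  exact: rpredB.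
split; apply/asboolP => J idJ sJ; case: (idJ) => _ _ /(_ a x) [] //;
  exact: Jx.
Qed.

End GeneratedIdeal.

Section Bessel.
Variables (K : fieldType) (alpha lambda : K).
Local Notation P := (spoly K).
Implicit Types p q : P.

Definition bessel1 p : P :=
  - (lambda *: d1 p) + z1 * d1 (d1 p) + z3 * d3 (d1 p) + z4 * d4 (d1 p)
  - (2 * alpha) *: (z2 * d3 (d4 p)).

Definition bessel2 p : P :=
  - ((lambda / alpha) *: d2 p) + z2 * d2 (d2 p) + z3 * d3 (d2 p)
  + z4 * d4 (d2 p) - 2 *: (z1 * d3 (d4 p)).

Definition bessel3 p : P :=
  - ((2 * lambda) *: d4 p) + 2 *: (z1 * d1 (d4 p))
  + (2 * alpha) *: (z2 * d2 (d4 p)) + (2 * (1 + alpha)) *: (z3 * d3 (d4 p))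
  + z3 * d1 (d2 p).

Definition bessel4 p : P :=
  (2 * lambda) *: d3 p - 2 *: (z1 * d1 (d3 p))
  - (2 * alpha) *: (z2 * d2 (d3 p)) - (2 * (1 + alpha)) *: (z4 * d4 (d3 p))
  + z4 * d1 (d2 p).

(* The operator B(z1)^m_0 B(z2)^m_1 B(z3)^e3 B(z4)^e4. *)
Definition bessel_monom (m : 'X_{1..2}) (e3 e4 : nat) q : P :=
  iter (m 0) bessel1 (iter (m 1) bessel2
    (iter e3 bessel3 (iter e4 bessel4 q))).

(* The operator p(B), applied to q. *)
Definition bessel_subst p q : P :=
    \sum_(m <- msupp (sp0 p)) (sp0 p)@_m *: bessel_monom m 0 0 q
  + \sum_(m <- msupp (sp3 p)) (sp3 p)@_m *: bessel_monom m 1 0 q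
  + \sum_(m <- msupp (sp4 p)) (sp4 p)@_m *: bessel_monom m 0 1 q
  + \sum_(m <- msupp (sp34 p)) (sp34 p)@_m *: bessel_monom m 1 1 q.

(* Only meaningful for lambda = alpha or lambda = 1. *)
Definition fock_gens : seq P :=
  if lambda == alpha then
    [:: 2 *: (z1 * z2) + z3 * z4; z2 ^+ 2; z2 * z3; z2 * z4]
  else
    [:: (2 * alpha) *: (z1 * z2) + z3 * z4; z1 ^+ 2; z1 * z3; z1 * z4].

End Bessel.

Section Fock.
Variables (R : realType) (alpha lambda : R).
Local Notation C := R[i].
Local Notation P := (spoly C).
Local Open Scope complex_scope.

Definition spoly_conj (q : P) : P :=
  SPoly (map_mpoly (@conjc R) (sp0 q)) (map_mpoly (@conjc R) (sp3 q))
        (map_mpoly (@conjc R) (sp4 q)) (map_mpoly (@conjc R) (sp34 q)).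

Definition bf_prod (p q : P) : C :=
  eval0 (bessel_subst alpha%:C lambda%:C p (spoly_conj q)).

Definition fock : zmodType :=
  Quotient.quot (gen_ideal (fock_gens alpha%:C lambda%:C)).

Definition fock_parity (e : bool) (x : fock) : Prop :=
  exists2 p : P, has_parity e p & x = \pi_fock p.

(* For lambda = alpha or lambda = 1, [bf_prod] vanishes as soon as one of its
   arguments lies in the ideal, so that the value does not depend on the
   representatives. *)
Definition fock_bf_prod (x y : fock) : C := bf_prod (repr x) (repr y).

End Fock.

(* Main.v *)
Require Import Defs.
From HB Require Import structures.
From mathcomp Require Import all_boot all_order all_algebra.
From mathcomp Require Import ring zify.
From mathcomp Require Import boolp reals complex mpoly.

Import GRing.Theory Num.Theory.
Local Open Scope ring_scope.

(** The product is studied first as the bilinear form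
    [bessel_form p q = p(B) q (0)] on the whole superpolynomial algebra, over
    an arbitrary numeric field and for an arbitrary [lambda]. The point is that
    it is supersymmetric there already, before any passage to the quotient:
    [bessel_form p q = bessel_form (parity_inv q) p] ([bessel_form_sym]), where
    [parity_inv] changes the sign of the odd part.

    By bilinearity this concerns pairs of monomials, that is, the entries
    [gram m e n f]. Two Euler operators, in which z1, resp. z2, has weight 2
    and both z3 and z4 have weight 1, are lowered by every Bessel operator by
    the weight of its variable; since the value at 0 of a vector of nonzero
    weight vanishes, an entry is nonzero only if the two monomials have the
    same weights ([gram_weight]). This leaves very few entries:
    - two equal monomials, for which there is nothing to prove in even degree,
      and where B(z3) and B(z4) act by zero in odd degree;
    - z^m z3 against z^m z4: the automorphism z3 -> z4, z4 -> - z3 commutes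
      with B(z1) and B(z2) and exchanges B(z3) and B(z4) up to sign ([gram_swap34]);
    - z^(m + 1) against z^m z3 z4, where both entries are computed in closed
      form and agree ([gram_even_even34], [gram_even34_even]).

    For [lambda = alpha] and [lambda = 1] the generators lie in an explicit
    two-sided ideal ([fock_null]) which the Bessel operators preserve and whose
    elements vanish at 0. Hence the form vanishes when its second argument lies
    in the Fock ideal, and by supersymmetry when the first one does. Finally
    [alpha] and [lambda] are real, so complex conjugation of the coefficients
    commutes with the Bessel operators, which turns supersymmetry of the
    bilinear form into superhermitian symmetry of the sesquilinear one. *)

(** * The Bessel operators in components *)

Section Components.
Context {K : fieldType}.
Implicit Types (alpha lambda : K) (p q : spoly K).
Local Notation x1 := ('X_(0 : 'I_2) : {mpoly K[2]}).
Local Notation x2 := ('X_(1 : 'I_2) : {mpoly K[2]}).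

Lemma mderiv_var : (((x1)^`M(0) = 1) * ((x1)^`M(1) = 0)
   * ((x2)^`M(0) = 0) * ((x2)^`M(1) = 1))%type.
Proof.
have e (i j : 'I_2) : ('X_j : {mpoly K[2]})^`M(i) = (j == i)%:R.
  rewrite mderivX mnm1E; case: eqP => [<-|_]; last by rewrite scale0r.
  rewrite scale1r (_ : (U_(j) - U_(j))%MM = 0%MM) ?mpolyX0 //.
  by apply/mnmP => k; rewrite mnmBE mnm0E subnn.
by split; [split; [split|]|]; rewrite e.
Qed.

Lemma mderiv1 (i : 'I_2) : (1 : {mpoly K[2]})^`M(i) = 0.
Proof. exact: mderivC. Qed.

Definition mderiv_simp i := (@mderivD 2 K i, @mderivN 2 K i, @mderivZ 2 K i,
  @mderivM 2 K i, mderiv_var, @mderiv0 2 K i, mderiv1 i).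

Lemma bessel1E alpha lambda p : bessel1 alpha lambda p =
  let B c f := (c - lambda) *: f^`M(0) + x1 * f^`M(0)^`M(0) in
  SPoly (B 0 (sp0 p) + (2 * alpha) *: (x2 * sp34 p))
        (B 1 (sp3 p)) (B 1 (sp4 p)) (B 2 (sp34 p)).
Proof. by apply: spolyP; split=> /=; rewrite -!mul_mpolyC; ring. Qed.

Lemma bessel2E alpha lambda p : bessel2 alpha lambda p =
  let B c f := (c - lambda / alpha) *: f^`M(1) + x2 * f^`M(1)^`M(1) in
  SPoly (B 0 (sp0 p) + 2 *: (x1 * sp34 p))
        (B 1 (sp3 p)) (B 1 (sp4 p)) (B 2 (sp34 p)).
Proof.
by apply: spolyP; split=> /=; rewrite -!mul_mpolyC; set s := _ / _; ring.
Qed.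

(** B(z3) is this operator after d4, and B(z4) is its opposite after d3, up to
    the terms that contain z3 or z4. *)
Definition bessel_odd alpha lambda (f : {mpoly K[2]}) :=
  - ((2 * lambda) *: f) + 2 *: (x1 * f^`M(0)) + (2 * alpha) *: (x2 * f^`M(1)).

Lemma bessel3E alpha lambda p : bessel3 alpha lambda p =
  let L := bessel_odd alpha lambda in
  SPoly (L (sp4 p))
    ((sp0 p)^`M(1)^`M(0) - L (sp34 p) - (2 * (1 + alpha)) *: sp34 p)
    0 (sp4 p)^`M(1)^`M(0).
Proof.
apply: spolyP; split=> /=; rewrite /bessel_odd ?mderiv_simp -!mul_mpolyC; ring.
Qed.

Lemma bessel4E alpha lambda p : bessel4 alpha lambda p =
  let L := bessel_odd alpha lambda in
  SPoly (- L (sp3 p)) 0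
    ((sp0 p)^`M(1)^`M(0) - L (sp34 p) - (2 * (1 + alpha)) *: sp34 p)
    (- (sp3 p)^`M(1)^`M(0)).
Proof.
apply: spolyP; split=> /=; rewrite /bessel_odd ?mderiv_simp -!mul_mpolyC; ring.
Qed.

End Components.

(** Identities between differential expressions: the Leibniz rule and the
    ordering of mixed derivatives reduce them to polynomial identities. *)
Local Ltac spoly_ring :=
  apply: spolyP; split; rewrite /= /bessel_odd ?mderiv_simp
    ?(mderiv_comm 1 0) -?mul_mpolyC; ring.

Section Linearity.
Context {K : fieldType}.
Implicit Types (alpha lambda c : K) (p q : spoly K).

Fact bessel1_linear alpha lambda : linear (bessel1 alpha lambda).
Proof. by move=> c p q; rewrite !bessel1E; spoly_ring. Qed.
Fact bessel2_linear alpha lambda : linear (bessel2 alpha lambda).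
Proof. by move=> c p q; rewrite !bessel2E; set s := _ / _; spoly_ring. Qed.
Fact bessel3_linear alpha lambda : linear (bessel3 alpha lambda).
Proof. by move=> c p q; rewrite !bessel3E; spoly_ring. Qed.
Fact bessel4_linear alpha lambda : linear (bessel4 alpha lambda).
Proof. by move=> c p q; rewrite !bessel4E; spoly_ring. Qed.

HB.instance Definition _ alpha lambda := GRing.isLinear.Build K (spoly K)
  (spoly K) _ (bessel1 alpha lambda) (bessel1_linear alpha lambda).
HB.instance Definition _ alpha lambda := GRing.isLinear.Build K (spoly K)
  (spoly K) _ (bessel2 alpha lambda) (bessel2_linear alpha lambda).
HB.instance Definition _ alpha lambda := GRing.isLinear.Build K (spoly K)
  (spoly K) _ (bessel3 alpha lambda) (bessel3_linear alpha lambda).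
HB.instance Definition _ alpha lambda := GRing.isLinear.Build K (spoly K)
  (spoly K) _ (bessel4 alpha lambda) (bessel4_linear alpha lambda).

Lemma iter_linear (B : spoly K -> spoly K) k : linear B -> linear (iter k B).
Proof.
move=> lB; elim: k => //= k IH c p q.
exact: etrans (congr1 B (IH c p q)) (lB c _ _).
Qed.

HB.instance Definition _ (B : {linear spoly K -> spoly K}) k :=
  GRing.isLinear.Build K (spoly K) (spoly K) _ (iter k B)
    (iter_linear B k (linearP B)).

Lemma linear_iterZ (B : {linear spoly K -> spoly K}) k c p :
  iter k B (c *: p) = c *: iter k B p.
Proof. exact: linearZ. Qed.

Lemma linear_iterD (B : {linear spoly K -> spoly K}) k p q :
  iter k B (p + q) = iter k B p + iter k B q.
Proof. exact: linearD. Qed.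

Fact bessel_monom_linear alpha lambda m e3 e4 :
  linear (bessel_monom alpha lambda m e3 e4).
Proof.
have comp (f g : spoly K -> spoly K) :
    linear f -> linear g -> linear (fun q : spoly K => f (g q)).
  by move=> lf lg c p q; exact: etrans (congr1 f (lg c p q)) (lf c _ _).
have lin1 := iter_linear _ (m 0) (bessel1_linear alpha lambda).
have lin2 := iter_linear _ (m 1) (bessel2_linear alpha lambda).
have lin3 := iter_linear _ e3 (bessel3_linear alpha lambda).
have lin4 := iter_linear _ e4 (bessel4_linear alpha lambda).
exact: (comp _ _ lin1 (comp _ _ lin2 (comp _ _ lin3 lin4))).
Qed.

HB.instance Definition _ alpha lambda m e3 e4 := GRing.isLinear.Build K
  (spoly K) (spoly K) _ (bessel_monom alpha lambda m e3 e4)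
  (bessel_monom_linear alpha lambda m e3 e4).

Fact eval0_linear : linear_for *%R (@eval0 K).
Proof. by move=> c p q; rewrite /eval0 /= mevalD mevalZ. Qed.

HB.instance Definition _ :=
  GRing.isLinear.Build K (spoly K) K _ (@eval0 K) eval0_linear.

Lemma eval0Z c p : eval0 (c *: p) = c * eval0 p.
Proof. exact: linearZ. Qed.

End Linearity.

(** * Expansion of the form in monomials *)

Section Monomials.
Context {K : fieldType}.
Implicit Types (alpha lambda c : K) (p q : spoly K) (i : 'I_2).
Implicit Types (e f : bool * bool) (m n : 'X_{1..2}).

(** The pair [e] holds the exponents of z3 and z4, so that the four components
    can be summed over. *)
Definition sp_coef p e : {mpoly K[2]} :=
  if e.1 then if e.2 then sp34 p else sp3 p
  else if e.2 then sp4 p else sp0 p.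

Definition zmon m e : spoly K :=
  let x e' := if e == e' then 'X_[m] else 0 in
  SPoly (x (false, false)) (x (true, false)) (x (false, true)) (x (true, true)).

Lemma sum_bool2 (V : zmodType) (F : bool * bool -> V) : \sum_e F e =
  F (false, false) + F (true, false) + F (false, true) + F (true, true).
Proof.
transitivity (\sum_a \sum_b F (a, b)); last first.
  by rewrite !big_bool /= (AC (2*2) (4*2*3*1)).
by rewrite pair_bigA; apply: eq_bigr => -[].
Qed.

Lemma sp_sum (I : Type) (s : seq I) (c : I -> K) (g : I -> spoly K) :
  \sum_(i <- s) c i *: g i =
  SPoly (\sum_(i <- s) c i *: sp0 (g i)) (\sum_(i <- s) c i *: sp3 (g i))
        (\sum_(i <- s) c i *: sp4 (g i)) (\sum_(i <- s) c i *: sp34 (g i)).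
Proof.
elim: s => [|a s IH]; first by rewrite !big_nil.
by rewrite !big_cons IH.
Qed.

Lemma spoly_expand p : p =
  \sum_e \sum_(m <- msupp (sp_coef p e)) (sp_coef p e)@_m *: zmon m e.
Proof.
have big0 s (g : 'X_{1..2} -> K) :
    \sum_(m <- s) g m *: (0 : {mpoly K[2]}) = 0.
  by rewrite big1_seq // => m _; rewrite scaler0.
rewrite sum_bool2 !sp_sum /zmon /=.
by apply: spolyP; split=> /=; rewrite !big0 ?add0r ?addr0 -mpolyE.
Qed.

Lemma bessel_subst_expand alpha lambda p q : bessel_subst alpha lambda p q =
  \sum_e \sum_(m <- msupp (sp_coef p e))
    (sp_coef p e)@_m *: bessel_monom alpha lambda m e.1 e.2 q.
Proof. by rewrite sum_bool2. Qed.

Definition bessel_form alpha lambda p q :=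
  eval0 (bessel_subst alpha lambda p q).

Definition gram alpha lambda m e n f : K :=
  eval0 (bessel_monom alpha lambda m e.1 e.2 (zmon n f)).

Lemma bessel_form_expand alpha lambda p q : bessel_form alpha lambda p q =
  \sum_e \sum_(m <- msupp (sp_coef p e))
    \sum_f \sum_(n <- msupp (sp_coef q f))
      (sp_coef p e)@_m * (sp_coef q f)@_n * gram alpha lambda m e n f.
Proof.
rewrite /bessel_form bessel_subst_expand linear_sum; apply: eq_bigr => e _.
rewrite linear_sum; apply: eq_bigr => m _ /=.
rewrite eval0Z {1}(spoly_expand q) !linear_sum /= mulr_sumr.
apply: eq_bigr => f _; rewrite !linear_sum /= mulr_sumr.
by apply: eq_bigr => n _; rewrite linearZ /= eval0Z mulrA.
Qed.

End Monomials.

(** * Weights *)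

Section Weights.
Context {K : fieldType}.
Implicit Types (alpha lambda c w : K) (p q : spoly K) (i : 'I_2).
Implicit Types (e : bool * bool) (m : 'X_{1..2}).

(** Twice the operator z_i d_i + (z3 d3 + z4 d4) / 2. Giving z3 z4 the weights
    of z1 z2 is what makes all four Bessel operators homogeneous. *)
Definition euler i p : spoly K :=
  let E w f := 2 *: ('X_i * f^`M(i)) + w *: f in
  SPoly (E 0 (sp0 p)) (E 1 (sp3 p)) (E 1 (sp4 p)) (E 2 (sp34 p)).

Definition weight i m e := (2 * m i + e.1 + e.2)%N.

Lemma eval0_euler i p : eval0 (euler i p) = 0.
Proof.
by rewrite /eval0 /= mevalD !mevalZ mevalM mevalXU mul0r mulr0 mul0r addr0.
Qed.

Lemma mulX_mderivX i m :
  'X_i * ('X_[m])^`M(i) = (m i)%:R *: ('X_[m] : {mpoly K[2]}).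
Proof.
rewrite mderivX; have [->|mi] := posnP (m i); first by rewrite !scale0r mulr0.
by rewrite -scalerAr -mpolyXD addmC submK // lep1mP -lt0n.
Qed.

Lemma euler_zmon i m e : euler i (zmon m e) = (weight i m e)%:R *: zmon m e.
Proof.
case: e => -[] []; apply: spolyP; rewrite /zmon /weight /=; split;
 rewrite ?mderiv0 ?mulr0 ?scaler0 ?addr0 // mulX_mderivX -!mul_mpolyC; ring.
Qed.

Lemma ord2P i : i = 0 \/ i = 1.
Proof. by case: i => [[|[|//]] h]; [left|right]; apply: val_inj. Qed.

Lemma ord10 : (((1 : 'I_2) == 0) = false) * (((0 : 'I_2) == 1) = false).
Proof. by []. Qed.

Lemma euler_bessel1 alpha lambda i p : euler i (bessel1 alpha lambda p) =
  bessel1 alpha lambda (euler i p)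
  - (2 * (i == 0)%:R) *: bessel1 alpha lambda p.
Proof.
by case: (ord2P i) => ->; rewrite ?eqxx ?ord10 !bessel1E; spoly_ring.
Qed.

Lemma euler_bessel2 alpha lambda i p : euler i (bessel2 alpha lambda p) =
  bessel2 alpha lambda (euler i p)
  - (2 * (i == 1)%:R) *: bessel2 alpha lambda p.
Proof.
by case: (ord2P i) => ->; rewrite ?eqxx ?ord10 !bessel2E; set s := _ / _;
  spoly_ring.
Qed.

Lemma euler_bessel3 alpha lambda i p : euler i (bessel3 alpha lambda p) =
  bessel3 alpha lambda (euler i p) - bessel3 alpha lambda p.
Proof. by case: (ord2P i) => ->; rewrite !bessel3E; spoly_ring. Qed.

Lemma euler_bessel4 alpha lambda i p : euler i (bessel4 alpha lambda p) =
  bessel4 alpha lambda (euler i p) - bessel4 alpha lambda p.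
Proof. by case: (ord2P i) => ->; rewrite !bessel4E; spoly_ring. Qed.

Definition lowers i c (B : spoly K -> spoly K) := forall w p,
  euler i p = w *: p -> euler i (B p) = (w - c) *: B p.

Lemma lowers_iter i c B k : lowers i c B -> lowers i (k%:R * c) (iter k B).
Proof.
move=> BE; elim: k => [|k IH] w p pE /=; first by rewrite mul0r subr0.
by rewrite (BE _ _ (IH _ _ pE)) -natr1 mulrDl mul1r opprD addrA.
Qed.

Lemma lowers_bessel_monom alpha lambda i m e :
  lowers i (weight i m e)%:R (bessel_monom alpha lambda m e.1 e.2).
Proof.
have L1 : lowers i (2 * (i == 0)%:R) (bessel1 alpha lambda).
  by move=> w p pE; rewrite euler_bessel1 pE linearZ scalerBl.
have L2 : lowers i (2 * (i == 1)%:R) (bessel2 alpha lambda).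
  by move=> w p pE; rewrite euler_bessel2 pE linearZ scalerBl.
have L3 : lowers i 1 (bessel3 alpha lambda).
  by move=> w p pE; rewrite euler_bessel3 pE linearZ scalerBl scale1r.
have L4 : lowers i 1 (bessel4 alpha lambda).
  by move=> w p pE; rewrite euler_bessel4 pE linearZ scalerBl scale1r.
move=> w p /(lowers_iter _ _ _ e.2 L4)/(lowers_iter _ _ _ e.1 L3) pE.
rewrite /bessel_monom.
rewrite (lowers_iter _ _ _ _ L1 _ _ (lowers_iter _ _ _ _ L2 _ _ pE)).
congr (_ *: _); rewrite /weight.
by case: (ord2P i) => ->; rewrite eqxx ord10 /= ?natrD ?natrM; ring.
Qed.

End Weights.

(** The vector whose value at 0 is the entry has as weights the differences of
    the weights of the two monomials, and a vector of nonzero weight vanishes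
    at 0. Characteristic zero turns the equality of weights in [K] into one of
    natural numbers. *)
Lemma gram_weight {K : numFieldType} (alpha lambda : K) (m n : 'X_{1..2})
    (e f : bool * bool) :
  gram alpha lambda m e n f != 0 -> forall i, weight i m e = weight i n f.
Proof.
move=> g0 i; apply/eqP; rewrite -(eqr_nat K) eq_sym -subr_eq0.
have := lowers_bessel_monom alpha lambda i m e _ _ (euler_zmon i n f).
move/(congr1 (@eval0 K)); rewrite eval0_euler linearZ => /esym/eqP.
by rewrite mulf_eq0 (negPf g0) orbF.
Qed.

(** * The odd monomials *)

Section OddEntries.
Context {K : fieldType}.
Implicit Types (alpha lambda : K) (p : spoly K) (m n : 'X_{1..2}).

(** The algebra automorphism z3 -> z4, z4 -> - z3. *)
Definition swap34 p : spoly K := SPoly (sp0 p) (- sp4 p) (sp3 p) (sp34 p).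

Lemma swap34_bessel1 alpha lambda p :
  swap34 (bessel1 alpha lambda p) = bessel1 alpha lambda (swap34 p).
Proof. by rewrite !bessel1E; spoly_ring. Qed.

Lemma swap34_bessel2 alpha lambda p :
  swap34 (bessel2 alpha lambda p) = bessel2 alpha lambda (swap34 p).
Proof. by rewrite !bessel2E; set s := _ / _; spoly_ring. Qed.

Lemma swap34_bessel3 alpha lambda p :
  swap34 (bessel3 alpha lambda p) = bessel4 alpha lambda (swap34 p).
Proof. by rewrite bessel3E bessel4E; spoly_ring. Qed.

(** The automorphism [swap34] does not change the value at 0 and sends
    B(z^m) B(z3) z^n z4 to - B(z^m) B(z4) z^n z3. *)
Lemma gram_swap34 alpha lambda m n :
  gram alpha lambda m (true, false) n (false, true) =
  - gram alpha lambda m (false, true) n (true, false).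
Proof.
have swap_iter (B : spoly K -> spoly K) k p :
    (forall q, swap34 (B q) = B (swap34 q)) ->
    swap34 (iter k B p) = iter k B (swap34 p).
  by move=> sB; elim: k => //= k <-.
rewrite /gram /bessel_monom /=.
transitivity (eval0 (swap34 (iter (m 0) (bessel1 alpha lambda)
   (iter (m 1) (bessel2 alpha lambda)
     (bessel3 alpha lambda (zmon n (false, true))))))) => //.
rewrite (swap_iter _ _ _ (swap34_bessel1 _ _)).
rewrite (swap_iter _ _ _ (swap34_bessel2 _ _)) swap34_bessel3.
have -> : swap34 (zmon n (false, true)) = - zmon n (true, false) :> spoly K.
  by apply: spolyP; split; rewrite /= ?oppr0.
by rewrite !linearN.
Qed.

Lemma gram_z3_z3 alpha lambda m n :
  gram alpha lambda m (true, false) n (true, false) = 0.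
Proof.
have B0 : bessel3 alpha lambda (zmon n (true, false)) = 0.
  rewrite bessel3E /zmon /bessel_odd /=; apply: spolyP; split;
    by rewrite /= ?(mderiv0, scaler0, mulr0, oppr0, addr0).
rewrite /gram -[bessel_monom _ _ _ _ _ _]/(bessel_monom alpha lambda m 0 0
  (bessel3 alpha lambda (zmon n (true, false)))).
by rewrite B0 (linear0 (bessel_monom alpha lambda m 0 0)) linear0.
Qed.

Lemma gram_z4_z4 alpha lambda m n :
  gram alpha lambda m (false, true) n (false, true) = 0.
Proof.
have B0 : bessel4 alpha lambda (zmon n (false, true)) = 0.
  rewrite bessel4E /zmon /bessel_odd /=; apply: spolyP; split;
    by rewrite /= ?(mderiv0, scaler0, mulr0, oppr0, addr0).
rewrite /gram -[bessel_monom _ _ _ _ _ _]/(bessel_monom alpha lambda m 0 0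
  (bessel4 alpha lambda (zmon n (false, true)))).
by rewrite B0 (linear0 (bessel_monom alpha lambda m 0 0)) linear0.
Qed.

End OddEntries.

(** * The even monomials *)

Section EvenEntries.
Context {K : fieldType}.
Implicit Types (alpha lambda s c : K) (i j k : nat).

Definition mon i j : {mpoly K[2]} := 'X_0 ^+ i * 'X_1 ^+ j.

Definition even_part (a d : {mpoly K[2]}) : spoly K := SPoly a 0 0 d.

Lemma mpolyX_mon (m : 'X_{1..2}) : 'X_[m] = mon (m 0) (m 1).
Proof.
rewrite mpolyXE_id !big_ord_recl big_ord0 mulr1 /mon.
by have -> : lift ord0 ord0 = 1 :> 'I_2 by apply: val_inj.
Qed.

Lemma zmon_even (m : 'X_{1..2}) :
  zmon m (false, false) = even_part (mon (m 0) (m 1)) 0 :> spoly K.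
Proof. by rewrite -mpolyX_mon. Qed.

Lemma zmon_even34 (m : 'X_{1..2}) :
  zmon m (true, true) = even_part 0 (mon (m 0) (m 1)) :> spoly K.
Proof. by rewrite -mpolyX_mon. Qed.

Lemma eval0_mon00 : eval0 (even_part (mon 0 0) 0) = 1 :> K.
Proof. by rewrite /eval0 /= /mon !expr0 mulr1 meval1. Qed.

Lemma mderiv_exp (p : {mpoly K[2]}) k (i : 'I_2) :
  (p ^+ k)^`M(i) = k%:R *: (p ^+ k.-1 * p^`M(i)).
Proof.
elim: k => [|k IH]; first by rewrite expr0 mderiv1 scale0r.
rewrite exprS mderivM IH /= -!mul_mpolyC.
by case: k {IH} => [|k] /=; rewrite ?exprS; ring.
Qed.

Lemma mderiv_mon0 i j : (mon i j)^`M(0) = i%:R *: mon i.-1 j.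
Proof. by rewrite mderivM !mderiv_exp !mderiv_var -!mul_mpolyC /mon; ring. Qed.
Lemma mderiv_mon1 i j : (mon i j)^`M(1) = j%:R *: mon i j.-1.
Proof. by rewrite mderivM !mderiv_exp !mderiv_var -!mul_mpolyC /mon; ring. Qed.

(** These are k! (0 - s)(1 - s)...(k-1 - s) and (k+1)! (1 - s)...(k - s); the
    first is the square norm of z2^k when s = lambda / alpha, and of z1^k when
    s = lambda. *)
Definition rprod s k : K := \prod_(i < k) (i.+1%:R * (i%:R - s)).
Definition sprod s k : K := \prod_(i < k) (i.+2%:R * (i.+1%:R - s)).

Lemma rprodS s k : rprod s k.+1 = rprod s k * (k.+1%:R * (k%:R - s)).
Proof. exact: big_ord_recr. Qed.
Lemma sprodS s k : sprod s k.+1 = sprod s k * (k.+2%:R * (k.+1%:R - s)).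
Proof. exact: big_ord_recr. Qed.
Lemma rprod_sprod s k : rprod s k.+1 = - s * sprod s k.
Proof.
elim: k => [|k IH]; last by rewrite rprodS IH sprodS -mulrA.
by rewrite rprodS /rprod /sprod !big_ord0; ring.
Qed.

Lemma bessel1_mon alpha lambda i j :
  bessel1 alpha lambda (even_part (mon i.+1 j) 0) =
  (i.+1%:R * (i%:R - lambda)) *: even_part (mon i j) 0.
Proof.
rewrite bessel1E; apply: spolyP; split;
  rewrite /= ?(mderiv_mon0, mderiv_simp) -!mul_mpolyC; try ring.
by case: i => [|i] /=; rewrite /mon ?exprS; ring.
Qed.

Lemma bessel2_mon alpha lambda i j :
  bessel2 alpha lambda (even_part (mon i j.+1) 0) =
  (j.+1%:R * (j%:R - lambda / alpha)) *: even_part (mon i j) 0.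
Proof.
rewrite bessel2E; set s := _ / _; apply: spolyP; split;
  rewrite /= ?(mderiv_mon1, mderiv_simp) -!mul_mpolyC; try ring.
by case: j => [|j] /=; rewrite /mon ?exprS; ring.
Qed.

Lemma bessel2_mon34 alpha lambda i j :
  bessel2 alpha lambda (even_part 0 (mon i j)) =
  (j%:R * (j.+1%:R - lambda / alpha)) *: even_part 0 (mon i j.-1)
  + 2 *: even_part (mon i.+1 j) 0.
Proof.
rewrite bessel2E; set s := _ / _; apply: spolyP; split;
  rewrite /= ?(mderiv_mon1, mderiv_simp) -!mul_mpolyC; try ring.
  by rewrite /mon exprS; ring.
by case: j => [|[|j]] /=; rewrite /mon ?exprS; ring.
Qed.

Lemma bessel34_mon alpha lambda i j :
  bessel3 alpha lambda (bessel4 alpha lambda (even_part (mon i.+1 j.+1) 0)) =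
  (i.+1%:R * j.+1%:R) *:
    ((2 * (i%:R + alpha * j%:R - lambda)) *: even_part (mon i j) 0
     + (i%:R * j%:R) *: even_part 0 (mon i.-1 j.-1)).
Proof.
rewrite bessel4E bessel3E; apply: spolyP; split; rewrite /= /bessel_odd
  ?(mderiv_mon0, mderiv_mon1, mderiv_simp) -!mul_mpolyC /=; try ring.
by case: i => [|i]; case: j => [|j]; rewrite /mon ?exprS /=; ring.
Qed.

Lemma iter_bessel1_mon alpha lambda i j :
  iter i (bessel1 alpha lambda) (even_part (mon i j) 0) =
  rprod lambda i *: even_part (mon 0 j) 0.
Proof.
elim: i => [|i IH]; first by rewrite /rprod big_ord0 scale1r.
by rewrite iterSr bessel1_mon linearZ /= IH scalerA rprodS mulrC.
Qed.

Lemma iter_bessel2_mon alpha lambda i j :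
  iter j (bessel2 alpha lambda) (even_part (mon i j) 0) =
  rprod (lambda / alpha) j *: even_part (mon i 0) 0.
Proof.
elim: j => [|j IH]; first by rewrite /rprod big_ord0 scale1r.
by rewrite iterSr bessel2_mon linearZ /= IH scalerA rprodS mulrC.
Qed.

(** With s = lambda / alpha, each application of B(z2) splits off a term
    without z3 z4. Collecting these terms is the induction step
    (j+1)(j+2-s) (1-s) ... (j-s) + (0-s)(1-s) ... (j-s)
    = (j+2)(j+1-s) (1-s) ... (j-s), up to a factor 2 (j+1)!. *)
Lemma iter_bessel2_mon34 alpha lambda i j :
  iter j.+1 (bessel2 alpha lambda) (even_part 0 (mon i j)) =
  (2 * sprod (lambda / alpha) j) *: even_part (mon i.+1 0) 0.
Proof.
elim: j => [|j IH].
  by rewrite /sprod big_ord0 /= bessel2_mon34 mul0r scale0r add0r mulr1.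
rewrite iterSr bessel2_mon34 linearD !linearZ /= -!iterS IH iter_bessel2_mon.
rewrite !scalerA -scalerDl rprod_sprod sprodS; congr (_ *: _).
by set s := _ / _; ring.
Qed.

Lemma gram_even_even34 alpha lambda (m n : 'X_{1..2}) :
  (forall i : 'I_2, m i = (n i).+1) ->
  gram alpha lambda m (false, false) n (true, true) =
  2 * sprod (lambda / alpha) (n 1) * rprod lambda (n 0).+1.
Proof.
move=> mn; rewrite /gram zmon_even34.
rewrite -[bessel_monom _ _ _ _ _ _]/(iter (m 0) (bessel1 alpha lambda)
  (iter (m 1) (bessel2 alpha lambda) (even_part 0 (mon (n 0) (n 1))))) !mn.
rewrite iter_bessel2_mon34 linear_iterZ iter_bessel1_mon !eval0Z eval0_mon00.
by rewrite mulr1.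
Qed.

(** B(z3) B(z4) z^m is a combination of z^n and of z^(n - 1) z3 z4, to which
    [iter_bessel2_mon] and [iter_bessel2_mon34] apply. With s = lambda / alpha
    and n = (i, j), the sum of the two contributions is the value in
    [gram_even_even34] because
    (i + alpha j - lambda) (- s) + i j = (i - lambda) (j - s). *)
Lemma gram_even34_even alpha lambda (m n : 'X_{1..2}) :
  alpha != 0 -> (forall i : 'I_2, m i = (n i).+1) ->
  gram alpha lambda n (true, true) m (false, false) =
  2 * sprod (lambda / alpha) (n 1) * rprod lambda (n 0).+1.
Proof.
move=> a0 mn; rewrite /gram zmon_even !mn.
rewrite -[bessel_monom _ _ _ _ _ _]/(iter (n 0) (bessel1 alpha lambda)
  (iter (n 1) (bessel2 alpha lambda) (bessel3 alpha lambda
    (bessel4 alpha lambda (even_part (mon (n 0).+1 (n 1).+1) 0))))).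
move: (n 0) (n 1) => i j; rewrite bessel34_mon.
have -> : iter j (bessel2 alpha lambda) ((i.+1%:R * j.+1%:R) *:
      ((2 * (i%:R + alpha * j%:R - lambda)) *: even_part (mon i j) 0
     + (i%:R * j%:R) *: even_part 0 (mon i.-1 j.-1))) =
   (i.+1%:R * j.+1%:R *
     (2 * (i%:R + alpha * j%:R - lambda) * rprod (lambda / alpha) j
      + 2 * (i%:R * j%:R) * sprod (lambda / alpha) j.-1))
   *: even_part (mon i 0) 0.
  rewrite -[RHS]scalerA [in RHS]scalerDl linear_iterZ linear_iterD.
  rewrite !linear_iterZ iter_bessel2_mon.
  congr (_ *: (_ + _)); first by rewrite scalerA.
  case: i => [|i]; first by rewrite !(mul0r, mulr0) !scale0r.
  case: j => [|j]; first by rewrite !(mul0r, mulr0) !scale0r.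
  rewrite [j.+1.-1]/= [i.+1.-1]/= iter_bessel2_mon34 scalerA.
  by congr (_ *: _); ring.
rewrite linear_iterZ iter_bessel1_mon !eval0Z eval0_mon00 mulr1 rprodS.
case: j => [|j]; first by rewrite /rprod /sprod !big_ord0; ring.
by rewrite rprod_sprod sprodS [j.+1.-1]/=; field.
Qed.

End EvenEntries.

(** * Supersymmetry of the form *)

Section Symmetry.
Context {K : numFieldType}.
Implicit Types (alpha lambda c : K) (p q r : spoly K) (i : 'I_2).
Implicit Types (e f : bool * bool) (m n : 'X_{1..2}).

Lemma gram_sym alpha lambda m e n f : alpha != 0 ->
  gram alpha lambda m e n f = (-1) ^+ (f.1 (+) f.2) * gram alpha lambda n f m e.
Proof.
move=> a0.
have [/forallP w|/forallP w] := boolP [forall i, weight i m e == weight i n f];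
    last first.
  have gram0 m' e' n' f' :
      (forall i, weight i m' e' = weight i n' f' ->
                 weight i m e = weight i n f) ->
      gram alpha lambda m' e' n' f' = 0.
    move=> h; apply/eqP/negP => /negP /gram_weight mn.
    by apply: w => i; apply/eqP/h.
  by rewrite !gram0 ?mulr0.
have {}w i : weight i m e = weight i n f by apply/eqP.
have eqmn : (e.1 + e.2 = f.1 + f.2)%N -> m = n.
  by move=> h; apply/mnmP => i; have := w i; rewrite /weight; lia.
(* Modulo 2 the weights are the parities, so an odd monomial is never paired
   with an even one. *)
have same_parity : odd (e.1 + e.2) = odd (f.1 + f.2).
  by have := w 0; rewrite /weight; lia.
case: e f w eqmn same_parity => -[] [] [] [] [] w eqmn // _;
  rewrite ?expr0 ?mul1r ?expr1 ?mulN1r /=.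
- by rewrite eqmn.
- have nm i : n i = (m i).+1 by have := w i; rewrite /weight /=; lia.
  by rewrite (gram_even34_even _ _ _ _ a0 nm) (gram_even_even34 _ _ _ _ nm).
- by rewrite !gram_z3_z3 oppr0.
- by rewrite eqmn // gram_swap34.
- by rewrite eqmn // gram_swap34 opprK.
- by rewrite !gram_z4_z4 oppr0.
- have mn i : m i = (n i).+1 by have := w i; rewrite /weight /=; lia.
  by rewrite (gram_even34_even _ _ _ _ a0 mn) (gram_even_even34 _ _ _ _ mn).
- by rewrite eqmn.
Qed.

Definition parity_inv p : spoly K :=
  SPoly (sp0 p) (- sp3 p) (- sp4 p) (sp34 p).

(** The sign is carried by [parity_inv q] so that the identity holds for
    non-homogeneous arguments, such as arbitrary elements of the Fock ideal. *)
Lemma bessel_form_sym alpha lambda p q : alpha != 0 ->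
  bessel_form alpha lambda p q = bessel_form alpha lambda (parity_inv q) p.
Proof.
move=> a0; rewrite !bessel_form_expand.
under eq_bigr => e _ do rewrite exchange_big.
rewrite exchange_big; apply: eq_bigr => f _ /=.
have -> : sp_coef (parity_inv q) f = (-1) ^+ (f.1 (+) f.2) *: sp_coef q f.
  by case: f => -[] []; rewrite /sp_coef /= ?scaleN1r ?scale1r.
rewrite [RHS](perm_big (msupp (sp_coef q f))); last first.
  by apply: msuppZ; rewrite signr_eq0.
under eq_bigr => e _ do rewrite exchange_big.
rewrite exchange_big; apply: eq_bigr => n _ /=.
apply: eq_bigr => e _; apply: eq_bigr => m _.
by rewrite gram_sym // mcoeffZ; ring.
Qed.

Lemma bessel_formBr alpha lambda p q r : bessel_form alpha lambda p (q - r) =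
  bessel_form alpha lambda p q - bessel_form alpha lambda p r.
Proof.
rewrite /bessel_form !bessel_subst_expand -!raddfB -sumrB; congr eval0.
apply: eq_bigr => e _; rewrite -sumrB; apply: eq_bigr => m _.
by rewrite linearB scalerBr.
Qed.

Lemma bessel_formZr alpha lambda c p q :
  bessel_form alpha lambda p (c *: q) = c * bessel_form alpha lambda p q.
Proof.
rewrite /bessel_form !bessel_subst_expand -eval0Z scaler_sumr; congr eval0.
apply: eq_bigr => e _; rewrite scaler_sumr; apply: eq_bigr => m _.
by rewrite linearZ /= !scalerA mulrC.
Qed.

(* Linearity in the first argument is deduced from symmetry, which avoids
   comparing the supports of the polynomials involved. *)
Lemma bessel_formZl alpha lambda c p q : alpha != 0 ->
  bessel_form alpha lambda (c *: p) q = c * bessel_form alpha lambda p q.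
Proof.
move=> a0; rewrite (bessel_form_sym _ _ (c *: p) q a0) bessel_formZr.
by rewrite -bessel_form_sym.
Qed.

Lemma parity_inv_homog (e : bool) p :
  has_parity e p -> parity_inv p = (-1) ^+ e *: p.
Proof.
by case: e => -[p1 p2]; apply: spolyP; split;
  rewrite /= ?scale1r ?scaleN1r ?p1 ?p2 ?oppr0.
Qed.

(** [bessel_form_sym] gives the sign of [q] alone. It is the expected sign when
    the parities agree; when they differ, using it twice shows that the form is
    equal to its opposite, hence zero. *)
Lemma bessel_form_supersym alpha lambda (d e : bool) p q : alpha != 0 ->
  has_parity d p -> has_parity e q ->
  bessel_form alpha lambda p q = (-1) ^+ (d * e) * bessel_form alpha lambda q p.
Proof.
move=> a0 hp hq.
have sym (e' : bool) p' q' : has_parity e' q' ->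
    bessel_form alpha lambda p' q' =
    (-1) ^+ e' * bessel_form alpha lambda q' p'.
  move=> hq'.
  by rewrite bessel_form_sym // (parity_inv_homog _ _ hq') bessel_formZl.
have [de|de] := eqVneq d e.
  by rewrite (sym _ p _ hq) de; case: (e).
have b0 : bessel_form alpha lambda p q = 0.
  have /eqP := etrans (sym _ p _ hq) (congr1 _ (sym _ q _ hp)).
  rewrite mulrA -signr_addb.
  have -> : e (+) d by case: (d) (e) de => -[].
  by rewrite mulN1r -subr_eq0 opprK -mulr2n mulrn_eq0 => /eqP.
by rewrite b0; have := sym _ q _ hp; rewrite b0 mulr0 => ->; rewrite mulr0.
Qed.

End Symmetry.

(** * The Fock ideal *)

Section Ideal.
Context {K : fieldType}.
Implicit Types (alpha lambda c : K) (p q r : spoly K) (x y : {mpoly K[2]}).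
Local Notation x1 := ('X_(0 : 'I_2) : {mpoly K[2]}).
Local Notation x2 := ('X_(1 : 'I_2) : {mpoly K[2]}).

(** The ideal generated by c x y + z3 z4, x^2, x z3 and x z4, when x and y are
    the even variables: the coefficients of 1, z3 and z4 are divisible by x,
    and modulo x^2 the first one is c x y times the coefficient of z3 z4. *)
Definition fock_null x y c p := exists u v w t,
  p = SPoly (x * (c *: (y * t) + x * u)) (x * v) (x * w) t.

Lemma fock_null_two_sided x y c : two_sided_ideal (fock_null x y c).
Proof.
split.
- by exists 0, 0, 0, 0; spoly_ring.
- move=> _ _ [u [v [w [t ->]]]] [u' [v' [w' [t' ->]]]].
  by exists (u - u'), (v - v'), (w - w'), (t - t'); spoly_ring.
move=> [r0 r3 r4 r34] _ [u [v [w [t ->]]]].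
set a := c *: (y * t) + x * u; split.
- exists (r0 * u - c *: (y * (r3 * w - r4 * v + r34 * a))), (r0 * v + r3 * a),
    (r0 * w + r4 * a), (r0 * t + x * (r3 * w - r4 * v + r34 * a)).
  by rewrite /a; spoly_ring.
exists (r0 * u - c *: (y * (r4 * v - r3 * w + r34 * a))), (r0 * v + r3 * a),
  (r0 * w + r4 * a), (r0 * t + x * (r4 * v - r3 * w + r34 * a)).
by rewrite /a; spoly_ring.
Qed.

Lemma fock_null_gens x y c g :
  g \in [:: c *: (spolyC x * spolyC y) + z3 * z4; spolyC x ^+ 2;
            spolyC x * z3; spolyC x * z4] ->
  fock_null x y c g.
Proof.
rewrite !inE => /or4P[] /eqP ->.
- by exists 0, 0, 0, 1; spoly_ring.
- by exists 1, 0, 0, 0; rewrite expr2; spoly_ring.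
- by exists 0, 1, 0, 0; spoly_ring.
- by exists 0, 0, 1, 0; spoly_ring.
Qed.

Lemma eval0_fock_null (i : 'I_2) y c p : fock_null 'X_i y c p -> eval0 p = 0.
Proof. by move=> [u [v [w [t ->]]]]; rewrite /eval0 /= mevalM mevalXU mul0r. Qed.

Definition bessel_stable alpha lambda (J : spoly K -> Prop) := forall p, J p ->
  [/\ J (bessel1 alpha lambda p), J (bessel2 alpha lambda p),
      J (bessel3 alpha lambda p) & J (bessel4 alpha lambda p)].

(* In the next two proofs the last witness is the z3 z4 component of the image,
   read off the formulas for the Bessel operators; the others are what remains
   of the other components after division by the even variable. The relation
   lambda = alpha, resp. lambda = 1, cancels the terms it does not divide. *)
Lemma bessel_stable_alpha alpha : alpha != 0 ->
  bessel_stable alpha alpha (fock_null x2 x1 2).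
Proof.
move=> a0 _ [u [v [w [t ->]]]].
rewrite bessel1E bessel2E bessel3E bessel4E divff //; split.
- exists (x1 * u^`M(0)^`M(0) - alpha *: u^`M(0)),
   ((1 - alpha) *: v^`M(0) + x1 * v^`M(0)^`M(0)),
   ((1 - alpha) *: w^`M(0) + x1 * w^`M(0)^`M(0)),
   ((2 - alpha) *: t^`M(0) + x1 * t^`M(0)^`M(0)).
  by spoly_ring.
- exists (3 *: u^`M(1) + x2 * u^`M(1)^`M(1)),
   (2 *: v^`M(1) + x2 * v^`M(1)^`M(1)),
   (2 *: w^`M(1) + x2 * w^`M(1)^`M(1)),
   (t^`M(1) + x2 * t^`M(1)^`M(1)).
  by spoly_ring.
- exists ((2 * alpha) *: w^`M(1) - 2 *: (x1 * w^`M(0)^`M(1))),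
   ((2 * (1 - alpha)) *: t^`M(1) + 2 *: (x1 * t^`M(0)^`M(1))
     + 2 *: u^`M(0) + x2 * u^`M(0)^`M(1)),
   0, (w^`M(0) + x2 * w^`M(0)^`M(1)).
  by spoly_ring.
- exists (2 *: (x1 * v^`M(0)^`M(1)) - (2 * alpha) *: v^`M(1)), 0,
   ((2 * (1 - alpha)) *: t^`M(1) + 2 *: (x1 * t^`M(0)^`M(1))
     + 2 *: u^`M(0) + x2 * u^`M(0)^`M(1)),
   (- (v^`M(0) + x2 * v^`M(0)^`M(1))).
  by spoly_ring.
Qed.

Lemma bessel_stable_one alpha : alpha != 0 ->
  bessel_stable alpha 1 (fock_null x1 x2 (2 * alpha)).
Proof.
move=> a0 _ [u [v [w [t ->]]]].
rewrite bessel1E bessel2E bessel3E bessel4E; split.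
- exists (3 *: u^`M(0) + x1 * u^`M(0)^`M(0)),
   (2 *: v^`M(0) + x1 * v^`M(0)^`M(0)),
   (2 *: w^`M(0) + x1 * w^`M(0)^`M(0)),
   (t^`M(0) + x1 * t^`M(0)^`M(0)).
  by spoly_ring.
- have [s sE as1] : exists2 s, s = 1 / alpha &
      alpha%:MP * s%:MP = 1 :> {mpoly K[2]}.
    by exists (1 / alpha) => //; rewrite -mpolyCM mul1r mulfV.
  rewrite -sE.
  exists (x2 * u^`M(1)^`M(1) - s *: u^`M(1)),
   ((1 - s) *: v^`M(1) + x2 * v^`M(1)^`M(1)),
   ((1 - s) *: w^`M(1) + x2 * w^`M(1)^`M(1)),
   ((2 - s) *: t^`M(1) + x2 * t^`M(1)^`M(1)).
  by apply: spolyP; split; rewrite /= ?mderiv_simp -?mul_mpolyC; ring: as1.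
- exists (2 *: w^`M(0) - (2 * alpha) *: (x2 * w^`M(0)^`M(1))),
   ((2 * (alpha - 1)) *: t^`M(0) + (2 * alpha) *: (x2 * t^`M(0)^`M(1))
     + 2 *: u^`M(1) + x1 * u^`M(0)^`M(1)),
   0, (w^`M(1) + x1 * w^`M(0)^`M(1)).
  by spoly_ring.
- exists ((2 * alpha) *: (x2 * v^`M(0)^`M(1)) - 2 *: v^`M(0)), 0,
   ((2 * (alpha - 1)) *: t^`M(0) + (2 * alpha) *: (x2 * t^`M(0)^`M(1))
     + 2 *: u^`M(1) + x1 * u^`M(0)^`M(1)),
   (- (v^`M(1) + x1 * v^`M(0)^`M(1))).
  by spoly_ring.
Qed.

Lemma bessel_form_null alpha lambda (J : spoly K -> Prop) p r :
  bessel_stable alpha lambda J -> (forall q, J q -> eval0 q = 0) -> J r ->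
  bessel_form alpha lambda p r = 0.
Proof.
move=> JB J0 Jr; rewrite /bessel_form bessel_subst_expand linear_sum.
rewrite big1 // => e _; rewrite linear_sum big1 // => m _ /=.
rewrite eval0Z J0 ?mulr0 // /bessel_monom.
have Jiter (B : spoly K -> spoly K) k q :
    (forall q', J q' -> J (B q')) -> J q -> J (iter k B q).
  by move=> BJ Jq; elim: k => //= k; apply: BJ.
by do 4![apply: (Jiter) => [q /JB[]//|]].
Qed.

Lemma bessel_form_ideal alpha lambda p r : alpha != 0 ->
  lambda = 1 \/ lambda = alpha ->
  r \in gen_ideal (fock_gens alpha lambda) -> bessel_form alpha lambda p r = 0.
Proof.
move=> a0 hl /asboolP; rewrite /fock_gens.
case: eqP hl => [-> _|la [l1|//]] Jr.
  apply: bessel_form_null (bessel_stable_alpha _ a0) (eval0_fock_null _ _ _) _.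
  apply: Jr; first exact: fock_null_two_sided.
  move=> g gg; apply: fock_null_gens; move: gg.
  suff -> : spolyC 'X_1 * spolyC 'X_0 = z1 * z2 :> spoly K by [].
  by rewrite /z1 /z2; spoly_ring.
rewrite l1 in Jr *.
apply: bessel_form_null (bessel_stable_one _ a0) (eval0_fock_null _ _ _) _.
apply: Jr; [exact: fock_null_two_sided|exact: fock_null_gens].
Qed.

End Ideal.

(** * Conjugation of the coefficients *)

Section Morphism.
Context {K : fieldType} (f : {rmorphism K -> K}) (alpha lambda : K).
Hypotheses (fa : f alpha = alpha) (fl : f lambda = lambda).

Definition spoly_map (p : spoly K) : spoly K :=
  SPoly (map_mpoly f (sp0 p)) (map_mpoly f (sp3 p))
        (map_mpoly f (sp4 p)) (map_mpoly f (sp34 p)).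

Lemma map_mpoly_mderiv (i : 'I_2) (u : {mpoly K[2]}) :
  map_mpoly f u^`M(i) = (map_mpoly f u)^`M(i).
Proof.
apply/mpolyP => m.
by rewrite mcoeff_map_mpoly !mcoeff_mderiv mcoeff_map_mpoly raddfMn.
Qed.

(* The ring structure of these statements is the one induced by the field [K],
   as in the components of the Bessel operators. *)
Lemma map_mpoly2Z c (u : {mpoly K[2]}) :
  map_mpoly f (c *: u) = f c *: map_mpoly f u.
Proof. exact: map_mpolyZ. Qed.
Lemma map_mpoly2M (u v : {mpoly K[2]}) :
  map_mpoly f (u * v) = map_mpoly f u * map_mpoly f v.
Proof. exact: rmorphM. Qed.
Lemma map_mpoly2D (u v : {mpoly K[2]}) :
  map_mpoly f (u + v) = map_mpoly f u + map_mpoly f v.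
Proof. exact: raddfD. Qed.
Lemma map_mpoly2N (u : {mpoly K[2]}) : map_mpoly f (- u) = - map_mpoly f u.
Proof. exact: raddfN. Qed.
Lemma map_mpoly2_0 : map_mpoly f (0 : {mpoly K[2]}) = 0.
Proof. exact: raddf0. Qed.
Lemma map_mpoly2X (m : 'X_{1..2}) :
  map_mpoly f ('X_[m] : {mpoly K[2]}) = 'X_[m].
Proof. exact: map_mpolyX. Qed.

Definition map_mpoly_simp := (map_mpoly2D, map_mpoly2N, map_mpoly2_0,
  map_mpoly2M, map_mpoly2Z, map_mpoly_mderiv, map_mpoly2X,
  rmorphD f, rmorphN f, rmorphM f, fmorphV f, rmorph_nat f, rmorph0 f,
  rmorph1 f, fa, fl).

Ltac map_bessel := apply: spolyP; split; rewrite /= /bessel_odd ?map_mpoly_simp.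

Lemma spoly_map_bessel1 p :
  spoly_map (bessel1 alpha lambda p) = bessel1 alpha lambda (spoly_map p).
Proof. by rewrite !bessel1E; map_bessel. Qed.
Lemma spoly_map_bessel2 p :
  spoly_map (bessel2 alpha lambda p) = bessel2 alpha lambda (spoly_map p).
Proof. by rewrite !bessel2E; map_bessel. Qed.
Lemma spoly_map_bessel3 p :
  spoly_map (bessel3 alpha lambda p) = bessel3 alpha lambda (spoly_map p).
Proof. by rewrite !bessel3E; map_bessel. Qed.
Lemma spoly_map_bessel4 p :
  spoly_map (bessel4 alpha lambda p) = bessel4 alpha lambda (spoly_map p).
Proof. by rewrite !bessel4E; map_bessel. Qed.

Lemma spoly_map_bessel_monom m e3 e4 p :
  spoly_map (bessel_monom alpha lambda m e3 e4 p) =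
  bessel_monom alpha lambda m e3 e4 (spoly_map p).
Proof.
have map_iter (B : spoly K -> spoly K) k q :
    (forall q', spoly_map (B q') = B (spoly_map q')) ->
    spoly_map (iter k B q) = iter k B (spoly_map q).
  by move=> fB; elim: k => //= k <-.
rewrite /bessel_monom (map_iter _ _ _ spoly_map_bessel1).
rewrite (map_iter _ _ _ spoly_map_bessel2) (map_iter _ _ _ spoly_map_bessel3).
by rewrite (map_iter _ _ _ spoly_map_bessel4).
Qed.

Lemma eval0_map p : eval0 (spoly_map p) = f (eval0 p).
Proof.
rewrite /eval0 /= !mevalE rmorph_sum (perm_big (msupp (sp0 p))) /=; last first.
  by apply: msupp_map_mpoly; apply: fmorph_inj.
apply: eq_bigr => m _; rewrite mcoeff_map_mpoly /= rmorphM rmorph_prod.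
by congr (_ * _); apply: eq_bigr => i _; rewrite rmorphXn rmorph0.
Qed.

Lemma bessel_form_map p q :
  bessel_form alpha lambda (spoly_map p) (spoly_map q) =
  f (bessel_form alpha lambda p q).
Proof.
rewrite /bessel_form !bessel_subst_expand !linear_sum /= rmorph_sum.
apply: eq_bigr => e _.
have -> : sp_coef (spoly_map p) e = map_mpoly f (sp_coef p e).
  by case: e => -[] [].
rewrite (perm_big (msupp (sp_coef p e))); last first.
  by apply: msupp_map_mpoly; apply: fmorph_inj.
rewrite !linear_sum /= rmorph_sum; apply: eq_bigr => m _.
by rewrite !eval0Z -spoly_map_bessel_monom eval0_map rmorphM mcoeff_map_mpoly.
Qed.

End Morphism.

(** * The Bessel-Fischer product *)

Section BesselFischer.
Local Open Scope complex_scope.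
Context {R : realType}.
Local Notation C := R[i].
Implicit Types (a l : R) (p q : spoly C).

Lemma bf_prodE a l p q :
  bf_prod a l p q = bessel_form a%:C l%:C p (spoly_conj q).
Proof. by []. Qed.

Lemma spoly_conjK : involutive (@spoly_conj R).
Proof.
move=> p; apply: spolyP; split; apply/mpolyP => m;
  by rewrite /= !mcoeff_map_mpoly; exact: conjcK.
Qed.

Lemma has_parity_conj e p : has_parity e p -> has_parity e (spoly_conj p).
Proof. by case: e => -[/= -> ->]; rewrite !raddf0. Qed.

Lemma conj_bessel_form a l p q : (bessel_form a%:C l%:C p q)^* =
  bessel_form a%:C l%:C (spoly_conj p) (spoly_conj q).
Proof.
by rewrite -(bessel_form_map (@conjc R) _ _ (conjc_real a) (conjc_real l)).
Qed.

Lemma conj_bf_prod a l p q :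
  (bf_prod a l p q)^* = bessel_form a%:C l%:C (spoly_conj p) q.
Proof. by rewrite bf_prodE conj_bessel_form spoly_conjK. Qed.

Lemma bf_prod_cong a l p p' q q' : a <> 0 -> l = 1 \/ l = a ->
  p - p' \in gen_ideal (fock_gens a%:C l%:C) ->
  q - q' \in gen_ideal (fock_gens a%:C l%:C) ->
  bf_prod a l p q = bf_prod a l p' q'.
Proof.
move=> /eqP a0 hl pp qq.
have {}a0 : a%:C != 0 by rewrite fmorph_eq0.
have {}hl : l%:C = 1 \/ l%:C = a%:C by case: hl => ->; [left|right].
have null r s t : s - t \in gen_ideal (fock_gens a%:C l%:C) ->
    bessel_form a%:C l%:C r s = bessel_form a%:C l%:C r t.
  move=> /(bessel_form_ideal _ _ r _ a0 hl)/eqP.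
  by rewrite bessel_formBr subr_eq0 => /eqP.
transitivity (bf_prod a l p' q).
  rewrite !bf_prodE (bessel_form_sym _ _ p _ a0) (bessel_form_sym _ _ p' _ a0).
  by rewrite (null _ _ _ pp).
(* Conjugating moves the conjugation from q to p', which makes the form linear
   in q and spares showing that conjugation preserves the ideal. *)
have E := etrans (conj_bf_prod a l p' q)
  (etrans (null _ _ _ qq) (esym (conj_bf_prod a l p' q'))).
exact: can_inj (@conjcK R) _ _ E.
Qed.

Lemma bf_prod_superhermitian a l (d e : bool) p q :
  a <> 0 -> has_parity d p -> has_parity e q ->
  bf_prod a l p q = (-1) ^+ (d * e) * (bf_prod a l q p)^*.
Proof.
move=> /eqP a0 hp hq; have {}a0 : a%:C != 0 by rewrite fmorph_eq0.
have hq' := has_parity_conj _ _ hq.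
apply: etrans (bessel_form_supersym _ l%:C _ _ _ _ a0 hp hq') _.
exact: congr1 _ (esym (conj_bf_prod a l q p)).
Qed.

End BesselFischer.

Local Open Scope complex_scope.

Theorem corollary5p7 (R : realType) (alpha lambda : R)
    (halpha0 : alpha <> 0) (halpha1 : alpha <> 1)
    (hlambda : lambda = 1 \/ lambda = alpha)
    (d e : bool) (p q : fock alpha lambda)
    (hp : fock_parity d p) (hq : fock_parity e q) :
  fock_bf_prod p q = (-1) ^+ (d * e) * (fock_bf_prod q p)^*.
Proof.
case: hp hq => [p0 hp0 pE] [q0 hq0 qE].
(* The canonical representatives need not be homogeneous. *)
have reprB (x : fock alpha lambda) x0 : x = \pi_(fock alpha lambda)%qT x0 ->
    repr x - x0 \in gen_ideal (fock_gens alpha%:C lambda%:C).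
  by move=> ->; rewrite Quotient.idealrBE reprK.
have rp := reprB _ _ pE; have rq := reprB _ _ qE.
rewrite /fock_bf_prod (bf_prod_cong _ _ _ _ _ _ halpha0 hlambda rp rq).
rewrite (bf_prod_cong _ _ _ _ _ _ halpha0 hlambda rq rp).
exact: bf_prod_superhermitian.
Qed.
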